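(* Let $r\ge 2$ and let $Q=(q_{ij})\in\mathbb{R}^{n\times n}$ be a rank-$r$ orthogonal projection. Then \[ \|Q\|_1=\sum_{i,j=1}^n|q_{ij}|\le \beta_r n,\qquad\text{where}\qquad \beta_r:=\frac{r+\sqrt{r+2}}{1+\sqrt{r+2}}. \]
   Context: A rank-$r$ orthogonal projection is a real $n\times n$ matrix $Q$ of rank $r$ with $Q=Q^2=Q^\top$. *)

(* Defs.v *)
From HB Require Import structures.
From mathcomp Require Import all_boot all_order all_algebra.
From mathcomp Require Import reals.

Set Implicit Arguments.
Unset Strict Implicit.
Unset Printing Implicit Defensive.

Import Order.TTheory GRing.Theory Num.Theory.
Local Open Scope ring_scope.

Definition orthogonal_projection (R : realType) (n r : nat) (Q : 'M[R]_n) : Prop :=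
  [/\ \rank Q = r, Q = Q *m Q & Q = Q^T].

Definition entrywise_l1norm (R : realType) (n : nat) (Q : 'M[R]_n) : R :=
  \sum_(i < n) \sum_(j < n) `|Q i j|.

Definition beta (R : realType) (r : nat) : R :=
  (r%:R + Num.sqrt (r%:R + 2)) / (1 + Num.sqrt (r%:R + 2)).

(* Main.v *)
Require Import Defs.
From HB Require Import structures.
From mathcomp Require Import all_boot all_order all_algebra.
From mathcomp Require Import reals.
From mathcomp Require Import ring lra.

Set Implicit Arguments.
Unset Strict Implicit.
Unset Printing Implicit Defensive.

Import Order.TTheory GRing.Theory Num.Theory.
Local Open Scope ring_scope.

(** Write [Q i j = <v_i, v_j>] with [v_i] the rows of [Q], put [a_i = |v_i|],
    [S = \sum_i a_i], [s = sqrt (r + 2)], and let [t_ij] be the cosine of the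
    angle between [v_i] and [v_j].  On [0, 1] one has
      [2 (s + 1)^2 t <= (s + 2) + s (s^2 + 2 s + 3) t^2 - s^3 t^4],
    the difference being [(s t - 1)^2 (1 - t) (s t + s + 2)], with equality at
    the cosines [1 / s] and [1] of a maximal equiangular tight frame.  Summing
    with weights [a_i a_j] leaves three quantities:
    - [S^2 <= n r], as [\sum_i a_i^2 = \tr Q = r];
    - [F2 = \sum_ij a_i a_j t_ij^2 <= n], which holds although the weights [a_i]
      do not make the frame tight;
    - [F4 = \sum_ij a_i a_j t_ij^4 >= 3 S^2 / (r (r + 2))], by Cauchy-Schwarz
      between [\sum_i a_i (v_i / a_i)^{(x) 4}] and the symmetrised square of the
      identity of the range of [Q].
    The weights below are [w_i = 1 / a_i], with [w_i = 0] when [v_i = 0]. *)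

(** * Preliminaries: Cauchy-Schwarz and the trace of an idempotent *)

Lemma sum_Cauchy_Schwarz (R : realFieldType) (I : finType) (f g : I -> R) :
  (\sum_i f i * g i) ^+ 2 <= (\sum_i f i ^+ 2) * (\sum_i g i ^+ 2).
Proof.
set u := \sum_i f i * g i; set x := \sum_i f i ^+ 2; set y := \sum_i g i ^+ 2.
have x0 : 0 <= x by apply: sumr_ge0 => i _; exact: sqr_ge0.
have key c d : 0 <= c ^+ 2 * x - 2 * c * d * u + d ^+ 2 * y.
  have -> : c ^+ 2 * x - 2 * c * d * u + d ^+ 2 * y
          = \sum_i (c * f i - d * g i) ^+ 2.
    rewrite /x /u /y !mulr_sumr -sumrB -big_split /=.
    by apply: eq_bigr => i _; ring.
  by apply: sumr_ge0 => i _; exact: sqr_ge0.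
have [x_eq0|x_neq0] := eqVneq x 0.
  have f0 i : f i = 0.
    apply/eqP; rewrite -sqrf_eq0; move/eqP: x_eq0.
    rewrite psumr_eq0 => [|j _]; last exact: sqr_ge0.
    by move=> /allP /(_ i (mem_index_enum i)).
  by rewrite x_eq0 /u big1 ?expr0n ?mul0r // => i _; rewrite f0 mul0r.
have xgt0 : 0 < x by rewrite lt_def x_neq0.
(* At [c = u], [d = x] the form factors as [x * (x * y - u ^+ 2)], and [x > 0] cancels. *)
have := key u x; rewrite (_ : _ + _ = x * (x * y - u ^+ 2)); last by ring.
by rewrite pmulr_rge0 // subr_ge0.
Qed.

Lemma sum_quadruple (R : nmodType) (I : finType) (F : I * I * I * I -> R) :
  \sum_t F t = \sum_k \sum_l \sum_m \sum_p F (k, l, m, p).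
Proof.
rewrite pair_bigA pair_bigA pair_bigA /=.
by apply: eq_bigr => -[[[k l] m] p].
Qed.

(** In the rank factorisation [Q = C B], idempotence reads [C B C B = C B]. Cancelling [C] on the
    left and [B] on the right gives [B C = 1], and the trace is cyclic. *)
Lemma mxtrace_idempotent (F : fieldType) (n : nat) (Q : 'M[F]_n) :
  Q = Q *m Q -> \tr Q = (\rank Q)%:R.
Proof.
move=> QQ.
have RC : row_base Q *m col_base Q = 1%:M.
  apply: (row_free_inj (row_base_free Q)); apply: (row_full_inj (col_base_full Q)).
  by rewrite mul1mx -mulmxA mulmxA !mulmx_base -QQ.
by rewrite -{1}(mulmx_base Q) mxtrace_mulC RC mxtrace1.
Qed.

(** * Entries of an orthogonal projection and their weighted second moment *)

Lemma proj_sym (R : realFieldType) (n : nat) (Q : 'M[R]_n) (QT : Q = Q^T) i j :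
  Q i j = Q j i.
Proof. by rewrite {1}QT mxE. Qed.

(** Sums out an index shared by two rows; the index computations below rest on it. [F] is kept
    abstract so that [ring] can bring a summand to the required shape. *)
Lemma proj_contract (R : realFieldType) (n : nat) (Q : 'M[R]_n)
    (QQ : Q = Q *m Q) (QT : Q = Q^T) (c : R) i j (F : 'I_n -> R) :
  (forall k, F k = c * (Q i k * Q j k)) -> \sum_k F k = c * Q i j.
Proof.
move=> FE; rewrite {1}QQ mxE mulr_sumr; apply: eq_bigr => k _.
by rewrite FE (proj_sym QT j k).
Qed.
Arguments proj_contract {R n Q} QQ QT c i j F.

Lemma proj_row_norm (R : realFieldType) (n : nat) (Q : 'M[R]_n)
    (QQ : Q = Q *m Q) (QT : Q = Q^T) i :
  \sum_k Q i k ^+ 2 = Q i i.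
Proof.
by rewrite (proj_contract QQ QT 1 i i) ?mul1r // => k; rewrite mul1r.
Qed.

Lemma proj_diag_ge0 (R : realFieldType) (n : nat) (Q : 'M[R]_n)
    (QQ : Q = Q *m Q) (QT : Q = Q^T) i : 0 <= Q i i.
Proof. by rewrite -proj_row_norm //; apply: sumr_ge0 => k _; exact: sqr_ge0. Qed.

Lemma proj_entry_le (R : realFieldType) (n : nat) (Q : 'M[R]_n)
    (QQ : Q = Q *m Q) (QT : Q = Q^T) i j : Q i j ^+ 2 <= Q i i * Q j j.
Proof.
rewrite -(proj_row_norm QQ QT i) -(proj_row_norm QQ QT j).
rewrite -[Q i j]mul1r -(proj_contract QQ QT 1 i j (fun k => Q i k * Q j k)).
  exact: sum_Cauchy_Schwarz.
by move=> k; rewrite mul1r.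
Qed.

(* With [T = \sum_j w_j v_j v_j^T], the sum is both [\sum_i w_i <v_i, T v_i>] and
   [|T|^2], and [(w_i <v_i, T v_i>)^2 <= |T v_i|^2] where the [|T v_i|^2] add up
   to [|T|^2] because [Q] is a projection. *)
Lemma proj_second_moment_le (R : realFieldType) (n : nat) (Q : 'M[R]_n)
    (QQ : Q = Q *m Q) (QT : Q = Q^T) (w : 'I_n -> R) :
  (forall i, w i ^+ 2 * Q i i <= 1) ->
  \sum_i \sum_j w i * w j * Q i j ^+ 2 <= n%:R.
Proof.
move=> wQ; set F := \sum_i _.
pose T k i := \sum_j w j * (Q k j * Q i j).
have F_diag : F = \sum_i w i * T i i.
  apply: eq_bigr => i _; rewrite mulr_sumr; apply: eq_bigr => j _; ring.
have F_norm : F = \sum_i \sum_k T k i ^+ 2.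
  have TT k i : T k i ^+ 2
      = \sum_j \sum_l w j * w l * (Q k j * Q k l * (Q i j * Q i l)).
    rewrite expr2 mulr_suml; apply: eq_bigr => j _.
    by rewrite mulr_sumr; apply: eq_bigr => l _; ring.
  under [RHS]eq_bigr => i _ do under eq_bigr => k _ do rewrite TT.
  under [RHS]eq_bigr => i _ do rewrite exchange_big.
  rewrite exchange_big; apply: eq_bigr => j _ /=.
  under [RHS]eq_bigr => i _ do rewrite exchange_big.
  rewrite exchange_big; apply: eq_bigr => l _ /=.
  have inner i : \sum_k w j * w l * (Q k j * Q k l * (Q i j * Q i l))
      = w j * w l * Q i j * Q i l * Q j l.
    apply: (proj_contract QQ QT) => k.
    by rewrite (proj_sym QT k j) (proj_sym QT k l); ring.
  under eq_bigr => i _ do rewrite inner.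
  rewrite (proj_contract QQ QT (w j * w l * Q j l) j l); first by ring.
  by move=> i; rewrite (proj_sym QT i j) (proj_sym QT i l); ring.
have T_diag i : T i i = \sum_k Q i k * T k i.
  under [RHS]eq_bigr => k _ do rewrite mulr_sumr.
  rewrite exchange_big; apply: eq_bigr => j _ /=.
  rewrite (proj_contract QQ QT (w j * Q i j) i j); first by ring.
  by move=> k; rewrite (proj_sym QT k j); ring.
have T_le i : (w i * T i i) ^+ 2 <= \sum_k T k i ^+ 2.
  rewrite exprMn T_diag.
  apply: le_trans (ler_wpM2l (sqr_ge0 _) (sum_Cauchy_Schwarz _ _)) _.
  rewrite proj_row_norm // mulrA ler_piMl //.
  by apply: sumr_ge0 => k _; exact: sqr_ge0.
(* Summing [2 x <= 1 + x ^+ 2] at [x = w i * T i i], with [T_le] and [F_norm], bounds [2 F] by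
   [n + F]. *)
suff : F + F <= n%:R + F by rewrite lerD2r.
rewrite {1 2}F_diag -big_split /= F_norm -[n in n%:R]card_ord -sumr_const.
rewrite -big_split /=; apply: ler_sum => i _.
have := T_le i; have := sqr_ge0 (w i * T i i - 1).
by move: (w i * T i i) (\sum_k _) => x y; nra.
Qed.

(** * Fourth moment by tensors of order four *)

(** One term per pairing of the four slots: three times the symmetrisation of [Q (x) Q], where [Q]
    stands for the identity of its range. *)
Definition sym_tensor (R : realFieldType) (n : nat) (Q : 'M[R]_n)
    (t : 'I_n * 'I_n * 'I_n * 'I_n) : R :=
  let: (k, l, m, p) := t in Q k l * Q m p + Q k m * Q l p + Q k p * Q l m.

Definition pow4_tensor (R : realFieldType) (n : nat) (Q : 'M[R]_n) (i : 'I_n)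
    (t : 'I_n * 'I_n * 'I_n * 'I_n) : R :=
  let: (k, l, m, p) := t in Q i k * Q i l * Q i m * Q i p.

Lemma dot_pow4_tensor (R : realFieldType) (n : nat) (Q : 'M[R]_n)
    (QQ : Q = Q *m Q) (QT : Q = Q^T) i j :
  \sum_t pow4_tensor Q i t * pow4_tensor Q j t = Q i j ^+ 4.
Proof.
rewrite sum_quadruple /=.
have H4 k l m : \sum_p Q i k * Q i l * Q i m * Q i p * (Q j k * Q j l * Q j m * Q j p)
    = Q i k * Q i l * Q i m * (Q j k * Q j l * Q j m) * Q i j.
  by apply: (proj_contract QQ QT) => p; ring.
under eq_bigr => k _ do under eq_bigr => l _ do under eq_bigr => m _ do rewrite H4.
have H3 k l : \sum_m Q i k * Q i l * Q i m * (Q j k * Q j l * Q j m) * Q i j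
    = Q i k * Q i l * (Q j k * Q j l) * Q i j * Q i j.
  by apply: (proj_contract QQ QT) => p; ring.
under eq_bigr => k _ do under eq_bigr => l _ do rewrite H3.
have H2 k : \sum_l Q i k * Q i l * (Q j k * Q j l) * Q i j * Q i j
    = Q i k * Q j k * Q i j * Q i j * Q i j.
  by apply: (proj_contract QQ QT) => p; ring.
under eq_bigr => k _ do rewrite H2.
rewrite (proj_contract QQ QT (Q i j * Q i j * Q i j) i j); first by ring.
by move=> k; ring.
Qed.

(** Each of the three pairings contributes [|v_i|^4], because [Q] fixes [v_i]. *)
Lemma dot_pow4_sym_tensor (R : realFieldType) (n : nat) (Q : 'M[R]_n)
    (QQ : Q = Q *m Q) (QT : Q = Q^T) i :
  \sum_t pow4_tensor Q i t * sym_tensor Q t = 3 * Q i i ^+ 2.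
Proof.
rewrite sum_quadruple /=.
have con := proj_contract QQ QT.
have H4 k l m :
    \sum_p Q i k * Q i l * Q i m * Q i p
           * (Q k l * Q m p + Q k m * Q l p + Q k p * Q l m)
    = Q i k * Q i l * Q k l * (Q i m * Q i m)
      + Q i k * (Q i l * Q i l) * (Q i m * Q k m)
      + Q i k * Q i k * Q i l * (Q i m * Q l m).
  rewrite (eq_bigr (fun p => Q i k * Q i l * Q i m * Q k l * (Q i p * Q m p)
     + Q i k * Q i l * Q i m * Q k m * (Q i p * Q l p)
     + Q i k * Q i l * Q i m * Q l m * (Q i p * Q k p))); last by move=> p _; ring.
  by rewrite !big_split /= !(con _ _ _ _ (fun=> erefl)); ring.
under eq_bigr => k _ do under eq_bigr => l _ do under eq_bigr => m _ do rewrite H4.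
have H3 k l : \sum_m (Q i k * Q i l * Q k l * (Q i m * Q i m)
      + Q i k * (Q i l * Q i l) * (Q i m * Q k m)
      + Q i k * Q i k * Q i l * (Q i m * Q l m))
    = Q i k * Q i i * (Q i l * Q k l) + 2 * (Q i k * Q i k) * (Q i l * Q i l).
  by rewrite !big_split /= !(con _ _ _ _ (fun=> erefl)); ring.
under eq_bigr => k _ do under eq_bigr => l _ do rewrite H3.
have H2 k :
    \sum_l (Q i k * Q i i * (Q i l * Q k l) + 2 * (Q i k * Q i k) * (Q i l * Q i l))
    = 3 * Q i i * (Q i k * Q i k).
  by rewrite !big_split /= !(con _ _ _ _ (fun=> erefl)); ring.
under eq_bigr => k _ do rewrite H2.
by rewrite (con _ _ _ _ (fun=> erefl)); ring.
Qed.

(** Of the nine products of two pairings, the three squares contribute [(\tr Q)^2] each, and the six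
    mixed ones close into a cycle worth [\tr (Q^4) = \tr Q]. *)
Lemma norm_sym_tensor (R : realFieldType) (n : nat) (Q : 'M[R]_n)
    (QQ : Q = Q *m Q) (QT : Q = Q^T) :
  \sum_t sym_tensor Q t ^+ 2 = 3 * \tr Q * (\tr Q + 2).
Proof.
rewrite sum_quadruple /=.
have con := proj_contract QQ QT.
have sym := proj_sym QT.
have trE c : \sum_k c * Q k k = c * \tr Q by rewrite -mulr_sumr.
have H4 k l m :
    \sum_p (Q k l * Q m p + Q k m * Q l p + Q k p * Q l m) ^+ 2
    = Q k l ^+ 2 * Q m m + Q l l * (Q k m * Q k m) + Q k k * (Q l m * Q l m)
      + 6 * Q k l * (Q k m * Q l m).
  rewrite (eq_bigr (fun p => Q k l ^+ 2 * (Q m p * Q m p)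
     + Q k m ^+ 2 * (Q l p * Q l p) + Q l m ^+ 2 * (Q k p * Q k p)
     + 2 * Q k l * Q k m * (Q m p * Q l p) + 2 * Q k l * Q l m * (Q m p * Q k p)
     + 2 * Q k m * Q l m * (Q l p * Q k p))); last by move=> p _; ring.
  rewrite !big_split /= !(con _ _ _ _ (fun=> erefl)).
  by rewrite (sym m l) (sym m k) (sym l k); ring.
under eq_bigr => k _ do under eq_bigr => l _ do under eq_bigr => m _ do rewrite H4.
have H3 k l :
    \sum_m (Q k l ^+ 2 * Q m m + Q l l * (Q k m * Q k m) + Q k k * (Q l m * Q l m)
            + 6 * Q k l * (Q k m * Q l m))
    = (\tr Q + 6) * (Q k l * Q k l) + 2 * Q k k * Q l l.
  by rewrite !big_split /= trE !(con _ _ _ _ (fun=> erefl)); ring.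
under eq_bigr => k _ do under eq_bigr => l _ do rewrite H3.
have H2 k : \sum_l ((\tr Q + 6) * (Q k l * Q k l) + 2 * Q k k * Q l l)
    = (3 * \tr Q + 6) * Q k k.
  by rewrite !big_split /= trE !(con _ _ _ _ (fun=> erefl)); ring.
under eq_bigr => k _ do rewrite H2.
by rewrite trE; ring.
Qed.

Lemma proj_fourth_moment_ge (R : realFieldType) (n : nat) (Q : 'M[R]_n)
    (QQ : Q = Q *m Q) (QT : Q = Q^T) (c : 'I_n -> R) :
  3 * (\sum_i c i * Q i i ^+ 2) ^+ 2
  <= \tr Q * (\tr Q + 2) * \sum_i \sum_j c i * c j * Q i j ^+ 4.
Proof.
have := sum_Cauchy_Schwarz (fun t => \sum_i c i * pow4_tensor Q i t)
                         (sym_tensor Q).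
rewrite norm_sym_tensor //.
have -> : \sum_t (\sum_i c i * pow4_tensor Q i t) * sym_tensor Q t
        = 3 * \sum_i c i * Q i i ^+ 2.
  under eq_bigr => t _ do rewrite mulr_suml.
  rewrite exchange_big mulr_sumr; apply: eq_bigr => i _ /=.
  under eq_bigr => t _ do rewrite -mulrA.
  by rewrite -mulr_sumr dot_pow4_sym_tensor //; ring.
have -> : \sum_t (\sum_i c i * pow4_tensor Q i t) ^+ 2
        = \sum_i \sum_j c i * c j * Q i j ^+ 4.
  under eq_bigr => t _ do rewrite expr2 mulr_suml.
  rewrite exchange_big; apply: eq_bigr => i _ /=.
  under eq_bigr => t _ do rewrite mulr_sumr.
  rewrite exchange_big; apply: eq_bigr => j _ /=.
  rewrite -dot_pow4_tensor // mulr_sumr; apply: eq_bigr => t _; ring.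
by move: (\sum_i _) (\sum_i _) (\tr Q) => x y z; nra.
Qed.

(** * The quartic bound on a single entry *)

Lemma abs_le_quartic (R : realFieldType) (s t : R) : 0 <= s -> 0 <= t <= 1 ->
  2 * (s + 1) ^+ 2 * t
  <= (s + 2) + s * (s ^+ 2 + 2 * s + 3) * t ^+ 2 - s ^+ 3 * t ^+ 4.
Proof.
move=> s0 /andP[t0 t1]; rewrite -subr_ge0.
rewrite (_ : _ - _ = (s * t - 1) ^+ 2 * ((1 - t) * (s * t + s + 2))); last by ring.
rewrite mulr_ge0 ?sqr_ge0 // mulr_ge0 ?subr_ge0 //.
by rewrite !addr_ge0 ?mulr_ge0.
Qed.

(** This is [abs_le_quartic] at the cosine [|Q i j| / (a i * a j)], scaled by [a i * a j]. *)
Lemma proj_entry_quartic (R : realFieldType) (n : nat) (Q : 'M[R]_n)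
    (QQ : Q = Q *m Q) (QT : Q = Q^T) (a : 'I_n -> R) (s : R) i j :
  (forall k, 0 <= a k) -> (forall k, a k ^+ 2 = Q k k) -> 0 <= s ->
  2 * (s + 1) ^+ 2 * `|Q i j|
  <= (s + 2) * (a i * a j)
     + s * (s ^+ 2 + 2 * s + 3) * ((a i)^-1 * (a j)^-1 * Q i j ^+ 2)
     - s ^+ 3 * ((a i)^-1 ^+ 3 * (a j)^-1 ^+ 3 * Q i j ^+ 4).
Proof.
move=> a0 a2 s0.
have q_le : `|Q i j| <= a i * a j.
  rewrite -(@ler_pXn2r _ 2) ?nnegrE ?mulr_ge0 //.
  by rewrite real_normK ?num_real // exprMn !a2 proj_entry_le.
have -> : Q i j ^+ 2 = `|Q i j| ^+ 2 by rewrite real_normK ?num_real.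
have -> : Q i j ^+ 4 = `|Q i j| ^+ 4.
  by rewrite !(exprM _ 2 2) real_normK ?num_real.
(* If one of the rows is zero, so is [Q i j], and every term vanishes whatever the inverses are. *)
have [aa0|aa_neq0] := eqVneq (a i * a j) 0.
  have -> : `|Q i j| = 0 by apply/eqP; rewrite eq_le normr_ge0 andbT -aa0.
  by rewrite aa0 !expr0n /= !mulr0 subr0 addr0.
have aa_gt0 : 0 < a i * a j by rewrite lt_def aa_neq0 mulr_ge0.
have := abs_le_quartic (t := `|Q i j| / (a i * a j)) s0.
rewrite divr_ge0 ?normr_ge0 ?(ltW aa_gt0) //= ler_pdivrMr // mul1r => /(_ q_le).
move/(ler_wpM2l (ltW aa_gt0)); move: aa_neq0; rewrite mulf_eq0 negb_or => /andP[ai aj].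
congr (_ <= _); by field; rewrite ai aj.
Qed.

(** * Assembling the bound *)

Theorem theorem3p1 (R : realType) (n r : nat) (Q : 'M[R]_n)
    (hr : (2 <= r)%N) (hQ : orthogonal_projection r Q) :
  entrywise_l1norm Q <= beta R r * n%:R.
Proof.
case: hQ => rk QQ QT.
have trQ : \tr Q = r%:R by rewrite mxtrace_idempotent // rk.
rewrite /entrywise_l1norm /beta.
have r2 : 2 <= r%:R :> R by rewrite ler_nat.
set s := Num.sqrt (r%:R + 2).
have s0 : 0 <= s by exact: sqrtr_ge0.
have s2 : s ^+ 2 = r%:R + 2 by rewrite sqr_sqrtr //; lra.
pose a i := Num.sqrt (Q i i).
have a2 i : a i ^+ 2 = Q i i by rewrite sqr_sqrtr ?proj_diag_ge0.
have N0 : 0 <= n%:R :> R by exact: ler0n.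
set L := \sum_i _; set N : R := n%:R in N0 *.
pose S := \sum_i a i.
pose F2 := \sum_i \sum_j (a i)^-1 * (a j)^-1 * Q i j ^+ 2.
pose F4 := \sum_i \sum_j (a i)^-1 ^+ 3 * (a j)^-1 ^+ 3 * Q i j ^+ 4.
have S_le : S ^+ 2 <= N * r%:R.
  have := sum_Cauchy_Schwarz (fun=> 1) a.
  under eq_bigr do rewrite mul1r.
  under [X in _ <= X * _]eq_bigr do rewrite expr1n.
  under [X in _ <= _ * X]eq_bigr do rewrite a2.
  by rewrite sumr_const card_ord -trQ.
have F2_le : F2 <= N.
  apply: proj_second_moment_le => // i; rewrite -a2.
  (* For a zero row the inverse is [0] by convention, and the weight condition reads [0 <= 1]. *)
  have [->|ai] := eqVneq (a i) 0; first by rewrite invr0 expr0n mul0r.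
  by rewrite -exprMn mulVf // expr1n.
have F4_ge : 3 * S ^+ 2 <= r%:R * (r%:R + 2) * F4.
  (* These weights turn each [c i * Q i i ^+ 2] into [a i], so the squared sum becomes [S ^+ 2]. *)
  have := proj_fourth_moment_ge QQ QT (fun i => (a i)^-1 ^+ 3).
  rewrite trQ (eq_bigr a) // => i _; rewrite -a2.
  have [->|ai] := eqVneq (a i) 0; first by rewrite expr0n /= expr0n mulr0.
  by field.
have L_le : 2 * (s + 1) ^+ 2 * L
    <= (s + 2) * S ^+ 2 + s * (s ^+ 2 + 2 * s + 3) * F2 - s ^+ 3 * F4.
  have -> : S ^+ 2 = \sum_i \sum_j a i * a j.
    by rewrite expr2 mulr_suml; apply: eq_bigr => i _; rewrite mulr_sumr.
  rewrite !mulr_sumr -big_split -sumrB /=; apply: ler_sum => i _.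
  rewrite !mulr_sumr -big_split -sumrB /=; apply: ler_sum => j _.
  by apply: proj_entry_quartic => // k; exact: sqrtr_ge0.
(* What remains is real arithmetic, with [r] replaced by [s ^+ 2 - 2]. *)
clearbody L S F2 F4 N s.
have rE : r%:R = s ^+ 2 - 2 by rewrite s2; ring.
rewrite {}rE in r2 S_le F4_ge *; clear trQ s2.
have s_ge2 : 2 <= s by nra.
have sum_le : 2 * (s + 1) ^+ 2 * L <= 2 * N * ((s + 2) * (s ^+ 2 - 1)).
  have F2' := ler_wpM2l (_ : 0 <= s * (s ^+ 2 + 2 * s + 3)) F2_le.
  have F4' : 3 * s * S ^+ 2 <= (s ^+ 2 - 2) * (s ^+ 3 * F4).
    have := ler_wpM2l s0 F4_ge; lra.
  (* After multiplication by [r = s ^+ 2 - 2], the lower bound on [F4] leaves [S ^+ 2] with this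
     coefficient. Its sign, which needs [s] large enough, allows the upper bound [S_le] to be
     used. *)
  have Q0 : 0 <= (s + 2) * (s ^+ 2 - 2) - 3 * s by nra.
  have S' := ler_wpM2l Q0 S_le.
  have {}F2' : s * (s ^+ 2 + 2 * s + 3) * F2 <= s * (s ^+ 2 + 2 * s + 3) * N.
    by apply: F2'; nra.
  have r0 : 0 < s ^+ 2 - 2 by lra.
  rewrite -(ler_pM2l r0).
  apply: le_trans (ler_wpM2l (ltW r0) L_le) _.
  have := ler_wpM2l (ltW r0) F2'.
  lra.
have s1 : 0 < 1 + s by lra.
rewrite mulrAC ler_pdivlMr //.
(* The numerator of [beta] is [s ^+ 2 + s - 2 = (s + 2) * (s - 1)], so this factor produces the
   right-hand side of [sum_le]. *)
rewrite -(@ler_pM2l _ (2 * (1 + s))); last by lra.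
lra.
Qed.
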